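(* Let $d\ge2$ and let $q^{\mathrm{pu}}$ be the $\varepsilon$-LDP $\texttt{PrivUnit}_2$ mechanism on $\mathbb{S}^{d-1}$ with parameters $p_0$ and $\gamma$ and estimator $\hat{\mathbf{x}}^{\mathrm{pu}}=\mathbf{z}/m_{\mathrm{pu}}$. Let $q^{\mathrm{mrc}}$ denote the MRC mechanism simulating $\texttt{PrivUnit}_2$ with $N$ candidates and estimator $\hat{\mathbf{x}}^{\mathrm{mrc}}=\mathbf{z}_K/m_{\mathrm{mrc}}$. Let $\lambda>0$. If \[ N\ge2e^{2\varepsilon}\Big(\frac{2(1+\lambda)}{\lambda(p_0-1/2)}\Big)^2\ln\Big(\frac{4(1+\lambda)}{\lambda(p_0-1/2)}\Big), \] then for every $\mathbf{x}\in\mathbb{S}^{d-1}$, with $E=\mathbb{E}_{q^{\mathrm{pu}}}[\|\hat{\mathbf{x}}^{\mathrm{pu}}-\mathbf{x}\|_2^2]$, \[ \mathbb{E}_{q^{\mathrm{mrc}}}\big[\|\hat{\mathbf{x}}^{\mathrm{mrc}}-\mathbf{x}\|_2^2\big]\le(1+\lambda)^2E+2(1+\lambda)(2+\lambda)\sqrt E+(2+\lambda)^2 . \]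
   Context: $\texttt{PrivUnit}_2$ with $\gamma\in[0,1]$, $p_0\ge1/2$ (chosen so that it is $\varepsilon$-LDP): on input $\mathbf{x}\in\mathbb{S}^{d-1}$ output $\mathbf{z}$ uniform on $\mathsf{Cap}_{\mathbf{x}}=\{\mathbf{z}\in\mathbb{S}^{d-1}:\langle\mathbf{z},\mathbf{x}\rangle\ge\gamma\}$ with probability $p_0$ and uniform on the complement otherwise; its density w.r.t. the uniform probability on the sphere is $q^{\mathrm{pu}}(\mathbf{z}\mid\mathbf{x})=p_0/\bar\theta$ on the cap and $(1-p_0)/(1-\bar\theta)$ off it, $\bar\theta$ being the uniform measure of the cap. For $p\in[0,1]$, $m(p)=\frac{(1-\gamma^2)^{\alpha}}{2^{d-2}(d-1)}\big[\frac{p}{B(\alpha,\alpha)-B(\tau;\alpha,\alpha)}-\frac{1-p}{B(\tau;\alpha,\alpha)}\big]$, $\alpha=\frac{d-1}2$, $\tau=\frac{1+\gamma}2$, $B(x;a,b)=\int_0^xt^{a-1}(1-t)^{b-1}dt$, $B(a,b)=B(1;a,b)$; $m_{\mathrm{pu}}=m(p_0)$. MRC: draw $\mathbf{z}_1,\dots,\mathbf{z}_N$ i.i.d. uniform on $\mathbb{S}^{d-1}$, $\pi^{\mathrm{mrc}}(k)=q^{\mathrm{pu}}(\mathbf{z}_k\mid\mathbf{x})/\sum_{k'}q^{\mathrm{pu}}(\mathbf{z}_{k'}\mid\mathbf{x})$, $K\sim\pi^{\mathrm{mrc}}$; $p_{\mathrm{mrc}}=\mathbb{P}(\mathbf{z}_K\in\mathsf{Cap}_{\mathbf{x}})$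 (over candidates and $K$) and $m_{\mathrm{mrc}}=m(p_{\mathrm{mrc}})$. Expectations under $q^{\mathrm{mrc}}$ are over the candidates and $K$. *)

(* Defs.v *)
From HB Require Import structures.
From mathcomp Require Import all_boot all_order all_algebra.
From mathcomp Require Import all_classical all_reals all_analysis.
Set Implicit Arguments. Unset Strict Implicit. Unset Printing Implicit Defensive.
Import Order.TTheory GRing.Theory Num.Theory.
Import numFieldNormedType.Exports.
Local Open Scope classical_set_scope.
Local Open Scope ring_scope.

Section PrivUnit.
Variable R : realType.

(* Points of R^d are d-tuples of reals (product sigma-algebra). *)
Definition dotv (d : nat) (u v : d.-tuple R) : R :=
  \sum_(i < d) tnth u i * tnth v i.

Definition sqdist (d : nat) (a b : d.-tuple R) : R :=
  \sum_(i < d) (tnth a i - tnth b i) ^+ 2.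

Definition scalev (d : nat) (c : R) (z : d.-tuple R) : d.-tuple R :=
  [tuple c * tnth z i | i < d].

Definition sphere (d : nat) : set (d.-tuple R) := [set z | dotv z z = 1].

Definition cap (d : nat) (gamma : R) (x : d.-tuple R) : set (d.-tuple R) :=
  [set z | @sphere d z /\ gamma <= dotv z x].

(* mu is the uniform probability measure on S^{d-1}: it is carried by the
   sphere and invariant under every orthogonal transformation of R^d
   (this characterizes it uniquely). *)
Definition uniform_on_sphere (d : nat) (mu : probability (d.-tuple R) R) : Prop :=
  mu (@sphere d) = 1%E /\
  forall f : d.-tuple R -> d.-tuple R,
    (forall u v, dotv (f u) (f v) = dotv u v) ->
    forall A, measurable A -> mu (f @^-1` A) = mu A.

Definition theta_bar (d : nat) (mu : probability (d.-tuple R) R)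
  (gamma : R) (x : d.-tuple R) : R := fine (mu (cap gamma x)).

(* density of PrivUnit_2 w.r.t. the uniform probability on the sphere *)
Definition q_pu (d : nat) (mu : probability (d.-tuple R) R) (p0 gamma : R)
  (x z : d.-tuple R) : R :=
  if gamma <= dotv z x then p0 / theta_bar mu gamma x
  else (1 - p0) / (1 - theta_bar mu gamma x).

Definition pu_law (d : nat) (mu : probability (d.-tuple R) R) (p0 gamma : R)
  (x : d.-tuple R) (S : set (d.-tuple R)) : \bar R :=
  (\int[mu]_(z in S) (q_pu mu p0 gamma x z)%:E)%E.

Definition pu_is_LDP (d : nat) (mu : probability (d.-tuple R) R)
  (p0 gamma eps : R) : Prop :=
  forall x x' : d.-tuple R, @sphere d x -> @sphere d x' ->
  forall S, measurable S ->
    (pu_law mu p0 gamma x S <= (expR eps)%:E * pu_law mu p0 gamma x' S)%E.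

Definition inc_beta (x a b : R) : R :=
  fine (\int[lebesgue_measure]_(t in `[0%R, x]%classic) (t `^ (a - 1) * (1 - t) `^ (b - 1))%:E)%E.
Definition beta_fun (a b : R) : R := inc_beta 1 a b.

Definition m_fun (d : nat) (gamma p : R) : R :=
  let alpha := (d%:R - 1) / 2 in
  let tau := (1 + gamma) / 2 in
  (1 - gamma ^+ 2) `^ alpha / (2 ^+ (d - 2) * (d%:R - 1)) *
  (p / (beta_fun alpha alpha - inc_beta tau alpha alpha)
   - (1 - p) / inc_beta tau alpha alpha).

Definition mse_pu (d : nat) (mu : probability (d.-tuple R) R) (p0 gamma : R)
  (x : d.-tuple R) : \bar R :=
  (\int[mu]_z (q_pu mu p0 gamma x z * sqdist (scalev (m_fun d gamma p0)^-1 z) x)%:E)%E.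

(* expectation over N i.i.d. candidates z_1..z_N ~ mu (iterated integral) *)
Fixpoint iter_int (d : nat) (mu : probability (d.-tuple R) R) (n : nat)
  (F : seq (d.-tuple R) -> \bar R) : \bar R :=
  match n with
  | 0 => F [::]
  | n'.+1 => (\int[mu]_z iter_int mu n' (fun s => F (z :: s)))%E
  end.

Definition pi_mrc (d : nat) (mu : probability (d.-tuple R) R) (p0 gamma : R)
  (x : d.-tuple R) (N : nat) (s : seq (d.-tuple R)) (k : nat) : R :=
  q_pu mu p0 gamma x (nth x s k) /
  \sum_(j < N) q_pu mu p0 gamma x (nth x s j).

(* p_mrc = P(z_K in Cap_x), over the candidates and K *)
Definition p_mrc (d : nat) (mu : probability (d.-tuple R) R) (p0 gamma : R)
  (x : d.-tuple R) (N : nat) : R :=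
  fine (iter_int mu N (fun s =>
    (\sum_(k < N) pi_mrc mu p0 gamma x N s k *
       (if gamma <= dotv (nth x s k) x then 1 else 0))%:E)).

Definition m_mrc (d : nat) (mu : probability (d.-tuple R) R) (p0 gamma : R)
  (x : d.-tuple R) (N : nat) : R := m_fun d gamma (p_mrc mu p0 gamma x N).

Definition mse_mrc (d : nat) (mu : probability (d.-tuple R) R) (p0 gamma : R)
  (x : d.-tuple R) (N : nat) : \bar R :=
  iter_int mu N (fun s =>
    (\sum_(k < N) pi_mrc mu p0 gamma x N s k *
       sqdist (scalev (m_mrc mu p0 gamma x N)^-1 (nth x s k)) x)%:E).

End PrivUnit.
Arguments sphere {R} d _.

(* Main.v *)
(**
Unit vectors have a bounded error: if [z] and [x] lie on the sphere and
[m_mrc > 0], then [|z / m_mrc - x| <= 1 / m_mrc + 1], while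
[|z / m_pu - x| >= 1 / m_pu - 1] gives [1 / m_pu <= 1 + sqrt E].  Hence it is
enough that [m_mrc >= m_pu / (1 + lambda)].  As [m] is affine in [p], increasing,
and nonnegative at [p = 1/2] (the Beta weight is symmetric, so the tail beyond
[tau >= 1/2] is the smaller part), this follows from [p_mrc >= p0 - delta] with
[delta = lambda (p0 - 1/2) / (1 + lambda)].

Given the candidates, [z_K] is in the cap with probability
[a u / (a u + b (1 - u))], where [u] is the fraction of candidates in the cap and
[a], [b] are the two values of the density.  Comparing [x] with [-x], the LDP
condition bounds [a / b] and [b / a] by [exp eps], so this differs from [p0] by at
most [exp eps * |u - theta|]; the variance of [u] and AM-GM conclude.
For [gamma = 1] one has [m = 0], both estimators vanish, and the bound is trivial.
*)

Require Import Defs.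
From HB Require Import structures.
From mathcomp Require Import all_boot all_order all_algebra.
From mathcomp Require Import all_classical all_reals all_analysis.
From mathcomp Require Import measurable_realfun ring lra.
Import Order.TTheory GRing.Theory Num.Theory.
Import numFieldNormedType.Exports.
Local Open Scope classical_set_scope.
Local Open Scope ring_scope.

(** * Beta integrals *)

(** By uniqueness of Lebesgue measure it is enough to check half-open intervals: the preimage of
    []a, b]] is [[1 - b, 1 - a[], of the same length. *)
Lemma lebesgue_measure_onem (R : realType) (A : set R) : measurable A ->
  pushforward lebesgue_measure (fun x => 1 - x : measurableTypeR R) A
  = lebesgue_measure A.
Proof.
move=> mA.
have mo : measurable_fun [set: measurableTypeR R]
    (fun x : R => 1 - x : measurableTypeR R).
  exact: measurable_funB.
apply/esym/lebesgue_measure_unique => //= _ [[a b]] _ <-.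
rewrite /pushforward/=.
have -> : (fun x : R => 1 - x) @^-1` `]a, b]%classic = `[1 - b, 1 - a[%classic.
  by apply/seteqP; split => x /=; rewrite !in_itv/=; lra.
rewrite !lebesgue_measure_itv/= !lte_fin.
have -> : (1 - b < 1 - a) = (a < b) by lra.
by case: ifP => // _; rewrite -!EFinB; congr EFin; lra.
Qed.

Lemma ge0_integral_onem (R : realType) (D : set R) (f : R -> \bar R) :
  measurable D -> measurable_fun D f -> (forall x, D x -> 0 <= f x)%E ->
  (\int[lebesgue_measure]_(x in D) f x =
   \int[lebesgue_measure]_(x in (fun x => 1 - x)%R @^-1` D) f (1 - x)%R)%E.
Proof.
move=> mD mf f0.
have mo : measurable_fun [set: measurableTypeR R]
    (fun x : R => 1 - x : measurableTypeR R).
  exact: measurable_funB.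
rewrite -[RHS](@ge0_integral_pushforward _ _ _ _ _ _ mo)//=; last first.
  by move=> x /set_mem; exact: f0.
by apply: eq_measure_integral => //= A mA AD; exact/esym/lebesgue_measure_onem.
Qed.

Lemma integral_rsqrt_le (R : realType) (e : R) : 0 < e -> e < 1 ->
  (\int[lebesgue_measure]_(t in `[e, 1%R]) (t `^ (- 2^-1))%:E <= 2%:E)%E.
Proof.
move=> e0 e1.
have pos x : e <= x -> 0 < x by lra.
have dF (x : R) : 0 < x -> is_derive x 1 (fun t : R => 2 * t `^ 2^-1) (x `^ (- 2^-1)).
  move=> x0; have := is_derive1_powR 2^-1 x0 => D.
  have := @is_deriveZ _ _ _ (fun t : R => t `^ 2^-1) 2 x 1 _ D.
  rewrite /GRing.scale/=; have -> : (2^-1 - 1 : R) = - 2^-1 by lra.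
  by rewrite mulrA mulfV// mul1r.
have cF (x : R) : 0 < x -> {for x, continuous (fun t : R => 2 * t `^ 2^-1)}.
  move=> x0; apply: differentiable_continuous; apply/derivable1_diffP.
  exact: (@ex_derive _ _ _ _ _ _ _ (dF x x0)).
rewrite (@continuous_FTC2 _ _ (fun t : R => 2 * t `^ 2^-1)) //.
- by rewrite -EFinB lee_fin powR1 mulr1 lerBlDr lerDl mulr_ge0// powR_ge0.
- apply: derivable_within_continuous => x; rewrite in_itv/= => /andP[ex _].
  by apply: derivable_powR; rewrite in_itv/= andbT pos.
- split.
  + move=> x; rewrite in_itv/= => /andP[ex _].
    exact: (@ex_derive _ _ _ _ _ _ _ (dF x (pos _ (ltW ex)))).
  + by apply: cvg_at_right_filter; exact: cF.
  + by apply: cvg_at_left_filter; apply: cF.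
- move=> x; rewrite in_itv/= => /andP[ex _].
  by rewrite derive1E; have := @derive_val _ _ _ _ _ _ _ (dF x (pos _ (ltW ex))).
Qed.

Lemma integral_rsqrt_lty (R : realType) :
  (\int[lebesgue_measure]_(t in `]0%R, 1%R]) (t `^ (- 2^-1) : R)%:E < +oo)%E.
Proof.
(* The shift by two keeps every left endpoint strictly below [1]; monotone convergence along these
   intervals gives the integral over []0, 1]]. *)
pose F (n : nat) : set R := `[n.+2%:R^-1, 1]%classic.
have UF : \bigcup_n F n = `]0, 1]%classic.
  apply/seteqP; split => x.
    move=> [n _]; rewrite /F/= !in_itv/= => /andP[h ->]; rewrite andbT.
    by apply: lt_le_trans h; rewrite invr_gt0.
  rewrite /= in_itv/= => /andP[x0 x1].
  have [n nx] : exists n : nat, x^-1 < n%:R.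
    exists (Num.truncn x^-1).+1; exact: truncnS_gt.
  exists n => //; rewrite /F/= in_itv/= x1 andbT.
  rewrite -[x]invrK lef_pV2 ?posrE ?invr_gt0//; apply: (le_trans (ltW nx)).
  by rewrite ler_nat -addn2 leq_addr.
have mf D : measurable D -> measurable_fun D (fun t : R => (t `^ (- 2^-1))%:E).
  by move=> mD; apply/measurable_EFinP; apply: measurable_funTS; exact: measurable_powR.
have C : (\int[lebesgue_measure]_(t in F i) (t `^ (- 2^-1))%:E @[i --> \oo] -->
    \int[lebesgue_measure]_(t in \bigcup_i F i) (t `^ (- 2^-1))%:E)%E.
  apply: ge0_nondecreasing_set_cvg_integral.
  - move=> m n mn; apply/subsetPset => x; rewrite /F/= !in_itv/= => /andP[h ->].
    by rewrite andbT; apply: le_trans h; rewrite lef_pV2 ?posrE// ler_nat !ltnS.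
  - by move=> i; exact: measurable_itv.
  - by move=> i; apply: mf; exact: measurable_itv.
  - by move=> i x _; rewrite lee_fin powR_ge0.
rewrite -UF; apply: (@le_lt_trans _ _ 2%:E); last exact: ltry.
apply: (cvge_to_le C); apply: nearW => n; apply: integral_rsqrt_le.
  by rewrite invr_gt0.
by rewrite invf_lt1// ltr1n.
Qed.

(** Only one factor can be large. The one with base at most [1/2] is bounded by an inverse square
    root, since [a - 1 >= -1/2]; the other has base [u >= 1/2] and is at most [u^-1 <= 2]. *)
Lemma beta_integrand_le (R : realType) (a t : R) : 2^-1 <= a -> 0 < t < 1 ->
  t `^ (a - 1) * (1 - t) `^ (a - 1) <= 2 * (t `^ (- 2^-1) + (1 - t) `^ (- 2^-1)).
Proof.
move=> a2 /andP[t0 t1].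
have le_rsqrt (u : R) : 0 < u -> u < 1 -> u `^ (a - 1) <= u `^ (- 2^-1).
  by move=> u0 u1; apply: ger_powR; [rewrite u0 ltW | lra].
have le2 (u : R) : 2^-1 <= u -> u < 1 -> u `^ (a - 1) <= 2.
  move=> u0 u1; have u00 : 0 < u by lra.
  apply: (@le_trans _ _ (u `^ (-1))); first by apply: ger_powR; [rewrite u00 ltW | lra].
  by rewrite powR_inv1 ?(ltW u00)// -[leRHS]invrK lef_pV2 ?posrE.
have [ht|ht] := leP t 2^-1.
- have h1 := le_rsqrt t t0 t1.
  have h2 : (1 - t) `^ (a - 1) <= 2 by apply: le2; lra.
  have := @ler_pM R _ _ _ _ (powR_ge0 _ _) (powR_ge0 _ _) h1 h2.
  have := powR_ge0 (1 - t) (- 2^-1); lra.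
- have h1 : (1 - t) `^ (a - 1) <= (1 - t) `^ (- 2^-1) by apply: le_rsqrt; lra.
  have h2 : t `^ (a - 1) <= 2 by apply: le2; lra.
  have := @ler_pM R _ _ _ _ (powR_ge0 _ _) (powR_ge0 _ _) h2 h1.
  have := powR_ge0 t (- 2^-1); lra.
Qed.

(** For a base in []0, 1]], raising the exponent from [a - 1] to [a] only lowers the power, and the
    power [a] is monotone in the base whatever the sign of [a - 1]. *)
Lemma beta_integrand_ge (R : realType) (a u v t : R) : 0 <= a ->
  0 < u -> v < 1 -> u <= t <= v ->
  u `^ a * (1 - v) `^ a <= t `^ (a - 1) * (1 - t) `^ (a - 1).
Proof.
move=> a0 u0 v1 /andP[ut tv].
have lepow (c s : R) : 0 < c -> c <= s -> s <= 1 -> c `^ a <= s `^ (a - 1).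
  move=> c0 cs s1; apply: (@le_trans _ _ (s `^ a)).
    by apply: ge0_ler_powR => //; rewrite ?nnegrE; lra.
  by apply: ger_powR; [apply/andP; split; lra | lra].
by apply: ler_pM; rewrite ?powR_ge0//; apply: lepow; lra.
Qed.

Lemma measurable_beta_integrand (R : realType) (a : R) (D : set R) :
  measurable_fun D (fun t : R => (t `^ (a - 1) * (1 - t) `^ (a - 1))%:E).
Proof.
apply/measurable_EFinP/measurable_funTS; apply: measurable_funM.
  exact: measurable_powR.
apply: (@measurableT_comp _ _ _ _ _ _ (fun x : R => x `^ (a - 1))).
  exact: measurable_powR.
exact: measurable_funB.
Qed.

Lemma beta_integral_lty (R : realType) (a : R) : 2^-1 <= a ->
  (\int[lebesgue_measure]_(t in `[0%R, 1%R])
     (t `^ (a - 1) * (1 - t) `^ (a - 1))%:E < +oo)%E.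
Proof.
move=> a2.
have mg (D : set R) : measurable_fun D (fun t : R => (t `^ (- 2^-1))%:E).
  by apply/measurable_EFinP/measurable_funTS; exact: measurable_powR.
have mg1 (D : set R) : measurable_fun D (fun t : R => ((1 - t) `^ (- 2^-1))%:E).
  apply/measurable_EFinP/measurable_funTS.
  apply: (@measurableT_comp _ _ _ _ _ _ (fun x : R => x `^ (- 2^-1))).
    exact: measurable_powR.
  exact: measurable_funB.
have I1 : (\int[lebesgue_measure]_(t in `]0%R, 1%R[) (t `^ (- 2^-1) : R)%:E < +oo)%E.
  apply: le_lt_trans (@integral_rsqrt_lty R); apply: ge0_subset_integral => //.
  - exact: mg.
  - by move=> x _; rewrite lee_fin powR_ge0.
  - by move=> x /=; rewrite !in_itv/= => /andP[-> /ltW].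
have I2 : (\int[lebesgue_measure]_(t in `]0%R, 1%R[) ((1 - t) `^ (- 2^-1) : R)%:E < +oo)%E.
  move: I1; rewrite (ge0_integral_onem _ _ _ _ (mg _))//; last first.
    by move=> x _; rewrite lee_fin powR_ge0.
  suff -> : (fun x : R => 1 - x) @^-1` `]0, 1[%classic = `]0, 1[%classic by [].
  by apply/seteqP; split => x /=; rewrite !in_itv/=; lra.
rewrite -integral_itv_bndo_bndc; last exact: measurable_beta_integrand.
rewrite -integral_itv_obnd_cbnd; last exact: measurable_beta_integrand.
apply: (@le_lt_trans _ _ (\int[lebesgue_measure]_(t in `]0%R, 1%R[)
   (2%:E * ((t `^ (- 2^-1))%:E + ((1 - t) `^ (- 2^-1))%:E)))%E).
  apply: ge0_le_integral => //.
  - by move=> x _; rewrite lee_fin mulr_ge0// powR_ge0.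
  - exact: measurable_beta_integrand.
  - by apply: measurable_funeM; apply: emeasurable_funD; [exact: mg|exact: mg1].
  - by move=> x /=; rewrite in_itv/= => hx; rewrite -EFinD -EFinM lee_fin beta_integrand_le.
rewrite ge0_integralZl_EFin//; last 2 first.
- by move=> x _; rewrite adde_ge0// lee_fin powR_ge0.
- by apply: emeasurable_funD; [exact: mg|exact: mg1].
rewrite ge0_integralD//; last 4 first.
- by move=> x _; rewrite lee_fin powR_ge0.
- exact: mg.
- by move=> x _; rewrite lee_fin powR_ge0.
- exact: mg1.
by rewrite lte_mul_pinfty// lte_add_pinfty.
Qed.

(** The difference is the integral over []tau, 1]]. Reflecting [t] to [1 - t] turns it into the
    integral of the same weight over [[0, 1 - tau[], a subset of [[0, tau]]. *)
Lemma inc_beta_complement (R : realType) (a tau : R) :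
  2^-1 <= a -> 2^-1 <= tau < 1 ->
  0 < Defs.beta_fun a a - inc_beta tau a a <= inc_beta tau a a.
Proof.
move=> a2 /andP[tau2 tau1].
pose w (t : R) := (t `^ (a - 1) * (1 - t) `^ (a - 1))%:E.
have w0 t : (0 <= w t)%E by rewrite lee_fin mulr_ge0 ?powR_ge0.
have mw D : measurable_fun D w by exact: measurable_beta_integrand.
have fin (D : set R) : measurable D -> D `<=` `[0, 1]%classic ->
    (\int[lebesgue_measure]_(t in D) w t)%E \is a fin_num.
  move=> mD D01; rewrite ge0_fin_numE; last by apply: integral_ge0.
  apply: le_lt_trans (beta_integral_lty _ a a2).
  by apply: ge0_subset_integral => //; exact: mw.
have s1 : `[0, tau]%classic `<=` `[0, 1 : R]%classic.
  by move=> t /=; rewrite !in_itv/= => /andP[-> /le_trans -> //]; exact: ltW.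
have s2 : `]tau, 1]%classic `<=` `[0, 1 : R]%classic.
  by move=> t /=; rewrite !in_itv/= => /andP[h ->]; rewrite andbT; lra.
have split01 : Defs.beta_fun a a = inc_beta tau a a +
    fine (\int[lebesgue_measure]_(t in `]tau, 1%R]) w t)%E.
  rewrite /Defs.beta_fun /inc_beta -fineD//; [|exact: fin|exact: fin].
  have -> : `[0, 1]%classic = `[0, tau]%classic `|` `]tau, 1]%classic :> set R.
    apply/seteqP; split => t /=; rewrite !in_itv/=; last by move=> []; lra.
    by move=> /andP[-> ->]/=; rewrite andbT; case: leP => _; [left|right].
  congr fine; rewrite ge0_integral_setU//; [exact: mw|by move=> x _; exact: w0|].
  by apply/disj_setPS => t [/=]; rewrite !in_itv/=; lra.
rewrite split01 (addrC (inc_beta _ _ _)) addrK; apply/andP; split.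
- apply: fine_gt0; apply/andP; split; last first.
    by rewrite -ge0_fin_numE; [exact: fin | exact: integral_ge0].
  (* Stopping at a midpoint [s < 1] leaves an interval of positive length on which the weight has a
     positive constant lower bound. *)
  pose s := (1 + tau) / 2; have s1' : s < 1 by rewrite /s; lra.
  have ts : tau < s by rewrite /s; lra.
  apply: (@lt_le_trans _ _ (\int[lebesgue_measure]_(t in `]tau, s])
      (tau `^ a * (1 - s) `^ a)%:E)%E).
    rewrite integral_cst//= lebesgue_measure_itv/= lte_fin ts -EFinB -EFinM lte_fin.
    by rewrite mulr_gt0 ?mulr_gt0 ?powR_gt0//; lra.
  apply: (@le_trans _ _ (\int[lebesgue_measure]_(t in `]tau, s]) w t)%E).
    apply: ge0_le_integral => //.
    + by move=> x _; rewrite lee_fin mulr_ge0 ?powR_ge0.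
    + exact: mw.
    + by move=> x /=; rewrite in_itv/= => /andP[h1 h2]; rewrite lee_fin
        beta_integrand_ge//; lra.
  apply: ge0_subset_integral => //; first exact: mw.
  by move=> x /=; rewrite !in_itv/= => /andP[-> h]/=; lra.
- rewrite /inc_beta fine_le//; [exact: fin|exact: fin|].
  rewrite (ge0_integral_onem _ _ _ _ (mw _))//.
  apply: (@le_trans _ _ (\int[lebesgue_measure]_(t in `[0%R, (1 - tau)%R[) w t)%E).
    rewrite le_eqVlt; apply/orP; left; apply/eqP.
    have -> : (fun x : R => 1 - x) @^-1` `]tau, 1]%classic = `[0, 1 - tau[%classic.
      by apply/seteqP; split => x /=; rewrite !in_itv/=; lra.
    apply: eq_integral => x _; rewrite /w; congr EFin.
    by rewrite mulrC; congr (_ `^ _ * _); lra.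
  apply: ge0_subset_integral => //; first exact: mw.
  by move=> x /=; rewrite !in_itv/=; lra.
Qed.

(** With [A] the tail, [B] the part below [tau] and [C > 0] the prefactor, the value at [1/2] is
    [C (1/A - 1/B) / 2], nonnegative as [A <= B], and the slope is [C (1/A + 1/B)]. *)
Lemma m_fun_affine (R : realType) (d : nat) (gamma : R) : (2 <= d)%N ->
  0 <= gamma < 1 -> exists c0 c1 : R, [/\ 0 <= c0, 0 < c1 &
  forall p, m_fun d gamma p = c0 + c1 * (p - 1 / 2)].
Proof.
move=> d2 /andP[g0 g1]; rewrite /m_fun.
set alpha := (d%:R - 1) / 2; set tau := (1 + gamma) / 2.
have d2R : (2 : R) <= d%:R by rewrite (ler_nat _ 2 d).
have := @inc_beta_complement R alpha tau.
have -> : 2^-1 <= alpha by rewrite /alpha; lra.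
have -> : 2^-1 <= tau < 1 by rewrite /tau; lra.
move=> /(_ isT isT).
set A := _ - inc_beta _ _ _; set B := inc_beta _ _ _ => /andP[A0 AB].
have B0 : 0 < B by exact: lt_le_trans AB.
set C := _ `^ _ / _.
have C0 : 0 < C.
  rewrite divr_gt0 ?powR_gt0 ?mulr_gt0 ?exprn_gt0//; last by lra.
  by have : gamma ^+ 2 < 1 by [rewrite expr_lt1]; lra.
exists (C * (A^-1 - B^-1) / 2), (C * (A^-1 + B^-1)); split.
- by rewrite divr_ge0// mulr_ge0 ?(ltW C0)// subr_ge0 lef_pV2 ?posrE.
- by rewrite mulr_gt0// addr_gt0 ?invr_gt0.
- by move=> p; field; rewrite !gt_eqF.
Qed.

Lemma m_fun1 (R : realType) (d : nat) (p : R) : (2 <= d)%N -> m_fun d 1 p = 0.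
Proof.
move=> d2; rewrite /m_fun expr1n subrr powR0 ?mul0r//.
have d2R : (2 : R) <= d%:R by rewrite (ler_nat _ 2 d).
by apply/eqP; lra.
Qed.

(** * Caps of the sphere *)

Lemma dotvC {R : realType} {d : nat} (u v : d.-tuple R) : dotv u v = dotv v u.
Proof. by apply: eq_bigr => i _; rewrite mulrC. Qed.

Lemma dotv_scalel {R : realType} {d : nat} (c : R) (u v : d.-tuple R) :
  dotv (scalev c u) v = c * dotv u v.
Proof. by rewrite mulr_sumr; apply: eq_bigr => i _; rewrite tnth_mktuple mulrA. Qed.

Lemma sqdistE {R : realType} {d : nat} (u v : d.-tuple R) :
  sqdist u v = dotv u u - 2 * dotv u v + dotv v v.
Proof.
rewrite /sqdist /dotv mulr_sumr -sumrB -big_split/=.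
by apply: eq_bigr => i _; ring.
Qed.

Lemma sqdist_ge0 {R : realType} {d : nat} (u v : d.-tuple R) : 0 <= sqdist u v.
Proof. by apply: sumr_ge0 => i _; exact: sqr_ge0. Qed.

(** Both bounds come from expanding the nonnegative squared distances from [u] and from [-u] to
    [v]. *)
Lemma dotv_unit_itv {R : realType} {d : nat} (u v : d.-tuple R) :
  sphere d u -> sphere d v -> -1 <= dotv u v <= 1.
Proof.
rewrite /sphere/= => u1 v1.
have := sqdist_ge0 u v; rewrite sqdistE u1 v1.
have := sqdist_ge0 (scalev (-1) u) v.
rewrite sqdistE dotv_scalel (dotvC u) !dotv_scalel u1 v1; lra.
Qed.

Lemma sqdist_scalev {R : realType} {d : nat} (c : R) (z x : d.-tuple R) :
  sphere d z -> sphere d x ->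
  sqdist (scalev c z) x = c ^+ 2 - 2 * c * dotv z x + 1.
Proof.
rewrite /sphere/= => z1 x1.
by rewrite sqdistE dotv_scalel (dotvC z) !dotv_scalel z1 x1; ring.
Qed.

Lemma sphereN {R : realType} {d : nat} (x : d.-tuple R) :
  sphere d x -> sphere d (scalev (-1) x).
Proof. by rewrite /sphere/= dotv_scalel dotvC dotv_scalel => ->; ring. Qed.

(* The reflection in the hyperplane orthogonal to [v]; it is the identity for
   [v = 0] because then the coefficient [2 / 0] is [0]. *)
Definition householder {R : realType} {d : nat} (v z : d.-tuple R) : d.-tuple R :=
  [tuple tnth z i - 2 / dotv v v * dotv z v * tnth v i | i < d].

Lemma dotv_householderl {R : realType} {d : nat} (v z u : d.-tuple R) :
  dotv (householder v z) u = dotv z u - 2 / dotv v v * dotv z v * dotv v u.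
Proof.
rewrite [LHS]/dotv [X in X - _]/dotv [X in _ * X]/dotv mulr_sumr -sumrB.
by apply: eq_bigr => i _; rewrite tnth_mktuple mulrBl !mulrA.
Qed.

Lemma dotv_householder {R : realType} {d : nat} (v u w : d.-tuple R) :
  dotv (householder v u) (householder v w) = dotv u w.
Proof.
rewrite dotv_householderl (dotvC u) (dotvC v) !dotv_householderl.
rewrite (dotvC w u) (dotvC w v) (dotvC v u).
have [->|D0] := eqVneq (dotv v v) 0; first by rewrite invr0; ring.
by field.
Qed.

(** The reflection along [x - y] exchanges the unit vectors [x] and [y] and is self-adjoint. If
    [x - y = 0] it is the identity, which is the separate case below. *)
Lemma dotv_householder_swap {R : realType} {d : nat} (x y z : d.-tuple R) :
  sphere d x -> sphere d y ->
  dotv (householder [tuple tnth x i - tnth y i | i < d] z) y = dotv z x.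
Proof.
rewrite /sphere/= => x1 y1; set v := [tuple _ | _ < d].
have dotvBl u : dotv v u = dotv x u - dotv y u.
  rewrite /dotv -sumrB; apply: eq_bigr => i _.
  by rewrite tnth_mktuple mulrBl.
rewrite dotv_householderl; have [v0|v0] := eqVneq (dotv v v) 0.
  rewrite v0 invr0 mulr0 !mul0r subr0 /dotv.
  apply: eq_bigr => i _; congr (_ * _); apply/esym/eqP.
  move/eqP: v0; rewrite /dotv psumr_eq0; last by move=> j _; rewrite -expr2 sqr_ge0.
  move=> /allP /(_ i (mem_index_enum _)) /=.
  by rewrite mulf_eq0 orbb tnth_mktuple subr_eq0.
have vvE : dotv v v = 2 - 2 * dotv x y.
  rewrite dotvBl (dotvC x v) (dotvC y v) !dotvBl x1 y1 (dotvC y x); ring.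
rewrite vvE in v0 *.
rewrite (dotvC z v) !dotvBl y1 (dotvC z y) (dotvC z x).
by field; move/eqP: v0 => v0; apply/eqP => h; apply: v0; lra.
Qed.

Lemma measurable_dotv {R : realType} {d : nat} (x : d.-tuple R) :
  measurable_fun [set: d.-tuple R] (fun z : d.-tuple R => dotv z x).
Proof.
rewrite /dotv; apply: measurable_sum => i; apply: measurable_funM => //.
exact: measurable_tnth.
Qed.

Lemma measurable_sphere (R : realType) (d : nat) :
  measurable (sphere d : set (d.-tuple R)).
Proof.
have m : measurable_fun [set: d.-tuple R] (fun z : d.-tuple R => dotv z z).
  rewrite /dotv; apply: measurable_sum => i.
  by apply: measurable_funM; exact: measurable_tnth.
rewrite -[sphere d]setTI.
exact: (m measurableT [set 1] (measurable_set1 _)).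
Qed.

Lemma measurable_halfspace {R : realType} {d : nat} (gamma : R) (x : d.-tuple R) :
  measurable ([set z | gamma <= dotv z x] : set (d.-tuple R)).
Proof.
have := measurable_dotv x measurableT `[gamma, +oo[%classic (measurable_itv _).
rewrite setTI; congr measurable; apply/seteqP.
by split => z /=; rewrite in_itv/= andbT.
Qed.

Lemma measurable_cap {R : realType} {d : nat} (gamma : R) (x : d.-tuple R) :
  measurable (cap gamma x).
Proof.
by apply: measurableI; [exact: measurable_sphere|exact: measurable_halfspace].
Qed.

(** The reflection exchanging [x] and [y] pulls the cap of [y] back to the cap of [x]. *)
Lemma cap_measure_invariant {R : realType} {d : nat}
    (mu : probability (d.-tuple R) R) (gamma : R) (x y : d.-tuple R) :
  uniform_on_sphere mu -> sphere d x -> sphere d y ->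
  mu (cap gamma x) = mu (cap gamma y).
Proof.
move=> [_ inv] x1 y1.
pose v := [tuple tnth x i - tnth y i | i < d].
rewrite -[RHS](inv (householder v) (dotv_householder v)); last exact: measurable_cap.
congr (mu _); apply/seteqP; split => z; rewrite /cap /sphere /=;
  by rewrite dotv_householder dotv_householder_swap.
Qed.

(** Normalised rational vectors give countably many cap centres. The zero vector stays zero, so
    membership in the sphere has to be tracked separately. *)
Definition rat_unit (R : realType) {d : nat} (r : d.-tuple rat) : d.-tuple R :=
  let v := [tuple ratr (tnth r i) : R | i < d] in
  scalev (Num.sqrt (dotv v v))^-1 v.

Lemma rat_unit_dense {R : realType} {d : nat} (gamma : R) (z : d.-tuple R) :
  gamma < 1 -> sphere d z ->
  exists r : d.-tuple rat, sphere d (rat_unit R r) /\ gamma <= dotv z (rat_unit R r).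
Proof.
(* [k] bounds the squared distance from [z] to the rational vector: [1/4] keeps that vector away
   from zero, and [1 - gamma] is the loss allowed in the inner product. *)
move=> g1 z1; pose k := Num.min (4^-1) (1 - gamma).
have k0 : 0 < k by rewrite lt_min subr_gt0 g1 andbT.
have k4 : k <= 4^-1 by rewrite ge_min lexx.
have kg : k <= 1 - gamma by rewrite ge_min lexx orbT.
pose eta := k / d.+1%:R; have eta0 : 0 < eta by rewrite divr_gt0.
have [q qP] : {q : 'I_d -> rat & forall i, `|tnth z i - ratr (q i)| < eta}.
  apply: (@choice _ _ (fun i q => `|tnth z i - ratr q| < eta)) => i.
  have [|q] := @rat_in_itvoo R (tnth z i - eta) (tnth z i + eta); first lra.
  rewrite in_itv/= => /andP[h1 h2]; exists q.
  by rewrite ltr_norml; apply/andP; split; lra.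
exists [tuple q i | i < d].
rewrite /rat_unit; set v := [tuple ratr _ | i < d].
have vE i : tnth v i = ratr (q i) by rewrite !tnth_mktuple.
pose s := sqdist z v.
have sk : s <= k.
  apply: (@le_trans _ _ (\sum_(i < d) eta ^+ 2)).
    apply: ler_sum => i _; rewrite -real_normK ?num_real// vE.
    by rewrite lerXn2r ?nnegrE// ?ltW.
  rewrite sumr_const card_ord -mulr_natl /eta.
  have d0 : (0 : R) < d.+1%:R by [].
  have dd : (d%:R : R) <= d.+1%:R by rewrite ler_nat.
  have d1 : (1 : R) <= d.+1%:R by rewrite ler1n.
  have -> : d%:R * (k / d.+1%:R) ^+ 2 = (d%:R / d.+1%:R) * ((k / d.+1%:R) * k).
    by field; rewrite gt_eqF.
  have h1 : (d%:R / d.+1%:R : R) <= 1 by rewrite ler_pdivrMr// mul1r.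
  have h2 : k / d.+1%:R <= 1 by rewrite ler_pdivrMr// mul1r; lra.
  have h3 : (k / d.+1%:R) * k <= k by rewrite ler_piMl// ltW.
  apply: le_trans h3; rewrite ler_piMl// mulr_ge0//; last exact: ltW.
  exact: ltW.
have := sqdistE z v; rewrite -/s; move: (z1); rewrite /sphere/= => -> sE.
(* Coordinatewise, [z^2 <= 2 v^2 + 2 (z - v)^2], the difference being [(z - 2 v)^2]. *)
have h : 1 <= 2 * dotv v v + 2 * s.
  rewrite -[leLHS]z1 /dotv /s /sqdist !mulr_sumr -big_split/=.
  apply: ler_sum => i _.
  have := sqr_ge0 (tnth z i - 2 * tnth v i); rewrite !expr2; lra.
have v4 : 4^-1 <= dotv v v by lra.
pose rho := Num.sqrt (dotv v v).
have rhoE : rho ^+ 2 = dotv v v by rewrite sqr_sqrtr//; lra.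
have rho0 : 0 <= rho by exact: sqrtr_ge0.
have rho2 : 2^-1 <= rho.
  by rewrite -(@ler_sqr R) ?nnegrE// rhoE; apply: le_trans v4; lra.
split.
  rewrite dotv_scalel (dotvC v) dotv_scalel -/rho -rhoE.
  by field; lra.
rewrite dotvC dotv_scalel -/rho mulrC ler_pdivlMr; last by lra.
rewrite dotvC.
(* From [2 <z, v> = 1 + rho^2 - s] and [1 + rho^2 >= 2 rho] one gets [<z, v> >= rho - s / 2]; then
   [s / 2 <= (1 - gamma) / 2 <= rho (1 - gamma)]. *)
have := sqr_ge0 (1 - rho); rewrite expr2.
have : 0 <= (rho - 2^-1) * (1 - gamma) by rewrite mulr_ge0; lra.
move: sE; rewrite -rhoE expr2; lra.
Qed.

(** If one cap were null, all caps of that height would be null by invariance. Countably many of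
    them, with rational directions as centres, cover the sphere, which has measure [1]. *)
Lemma cap_measure_gt0 {R : realType} {d : nat} (mu : probability (d.-tuple R) R)
    (gamma : R) (x : d.-tuple R) :
  uniform_on_sphere mu -> gamma < 1 -> sphere d x -> (0 < mu (cap gamma x))%E.
Proof.
move=> umu g1 x1; rewrite lt0e measure_ge0 andbT; apply/eqP => mu0.
pose F (n : nat) : set (d.-tuple R) :=
  if unpickle n is Some r then
    [set z | sphere d (rat_unit R r) /\ cap gamma (rat_unit R r) z]
  else set0.
have F0 n : mu.-negligible (F n).
  rewrite /F; case: unpickle => [r|]; last exact: negligible_set0.
  have [y1|ny1] := pselect (sphere d (rat_unit R r)).
    apply: (@negligibleS _ _ _ _ (cap gamma (rat_unit R r))); first by move=> z [].
    apply/negligibleP; first exact: measurable_cap.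
    by rewrite -mu0; exact: cap_measure_invariant.
  by apply: (negligibleS _ (negligible_set0 mu)) => z [].
have sub : sphere d `<=` \bigcup_n F n.
  move=> z z1; have [r [r1 rz]] := rat_unit_dense _ _ g1 z1.
  by exists (pickle r) => //; rewrite /F pickleK.
have := negligibleS sub (negligible_bigcup F0).
have ms := measurable_sphere R d.
move=> /(negligibleP _ ms) s0; have := umu.1.
by apply/eqP; rewrite [X in X == _]s0 eq_sym onee_eq0.
Qed.

(** * Expectations over the candidates *)

(** The integral of a nonnegative function is a supremum over the simple functions below it, so
    monotonicity holds without measurability. This allows bounds on iterated integrals of arbitrary
    nonnegative integrands. *)
Lemma ge0_le_integralT (dp : measure_display) (T : measurableType dp)
    (R : realType) (mu : {measure set T -> \bar R}) (f g : T -> \bar R) :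
  (forall z, 0 <= f z)%E -> (forall z, f z <= g z)%E ->
  (\int[mu]_z f z <= \int[mu]_z g z)%E.
Proof.
move=> f0 fg; rewrite !ge0_integralTE//; last first.
  by move=> z; exact: le_trans (f0 z) (fg z).
by apply: ereal_sup_le => _ [h hf <-]; exists h => // z; exact: le_trans (hf z) (fg z).
Qed.

Lemma integral_if (dp : measure_display) (T : measurableType dp)
    (R : realType) (mu : {measure set T -> \bar R}) (c : T -> bool) (u v : \bar R) :
  measurable [set z | c z] ->
  (\int[mu]_z (if c z then u else v) =
   u * mu [set z | c z] + v * mu (~` [set z | c z]))%E.
Proof.
move=> mc; rewrite -(setUv [set z | c z]) integral_setU//; last 3 first.
- exact: measurableC.
- rewrite setUv; apply: measurable_fun_ifT => //.
  by apply: (measurable_fun_bool true); rewrite setTI.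
- by apply/disj_set2P; rewrite setICr.
congr (_ + _)%E.
  rewrite -integral_cst//; apply: eq_integral => z.
  by rewrite inE/= => ->.
rewrite -integral_cst//; last exact: measurableC.
by apply: eq_integral => z; rewrite inE/= => /negP/negbTE ->.
Qed.

Lemma integral_if_EFin (dp : measure_display) (T : measurableType dp)
    (R : realType) (mu : probability T R) (c : T -> bool) (u v : R) :
  measurable [set z | c z] ->
  (\int[mu]_z (if c z then u else v)%:E =
   (fine (mu [set z | c z]) * u + (1 - fine (mu [set z | c z])) * v)%:E)%E.
Proof.
move=> mc; rewrite (eq_integral (fun z => if c z then u%:E else v%:E)); last first.
  by move=> z _; case: ifP.
rewrite integral_if// [X in (_ + _ * X)%E](probability_setC mu mc).
have tE : mu [set z | c z] = (fine (mu [set z | c z]))%:E by rewrite fineK// fin_num_measure.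
rewrite [X in (_ * X + _)%E]tE [X in (_ * (1 - X))%E]tE; set t := fine _.
by rewrite -EFinB -!EFinM -EFinD; congr EFin; ring.
Qed.

Lemma integral_sphere_le {R : realType} {d : nat} (mu : probability (d.-tuple R) R)
    (M : R) (g : d.-tuple R -> \bar R) :
  mu (sphere d) = 1%E -> (forall z, 0 <= g z)%E ->
  (forall z, sphere d z -> g z <= M%:E)%E -> (\int[mu]_z g z <= M%:E)%E.
Proof.
move=> mu1 g0 gM; pose c (z : d.-tuple R) := dotv z z == 1.
have cE : [set z | c z] = sphere d by apply/seteqP; split => z /eqP.
(* Nothing is known about [g] off the sphere, so the majorant is infinite there; the complement is
   null and contributes [+oo * 0 = 0]. *)
apply: (@le_trans _ _ (\int[mu]_z (if c z then M%:E else +oo))%E).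
  apply: ge0_le_integralT => // z.
  by case: ifPn => [/eqP/gM//|_]; rewrite leey.
have ms := measurable_sphere R d.
rewrite integral_if cE// [X in (_ * X + _)%E]mu1 mule1.
by rewrite [X in (_ + _ * X)%E](probability_setC mu ms) mu1 subee// mule0 adde0.
Qed.

(** The density tests only the inner product, whereas [theta_bar] measures the cap; the two sets
    differ by a null set. *)
Lemma halfspace_measure {R : realType} {d : nat} (mu : probability (d.-tuple R) R)
    (gamma : R) (x : d.-tuple R) : mu (sphere d) = 1%E ->
  mu [set z | gamma <= dotv z x] = mu (cap gamma x).
Proof.
move=> mu1; have mH := measurable_halfspace gamma x.
have ms := measurable_sphere R d.
have D0 : mu ([set z | gamma <= dotv z x] `\` sphere d) = 0%E.
  apply/eqP; rewrite eq_le measure_ge0 andbT.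
  apply: (@le_trans _ _ (mu (~` sphere d))).
    apply: le_measure; rewrite ?inE; last by move=> z [].
      exact: measurableD.
    exact: measurableC.
  by rewrite [leLHS](probability_setC mu ms) mu1 subee.
rewrite [LHS](measureDI mu mH ms) [X in (X + _)%E]D0.
by rewrite add0e setIC.
Qed.

Lemma iter_int_ge0 {R : realType} {d : nat} (mu : probability (d.-tuple R) R)
    (n : nat) (F : seq (d.-tuple R) -> \bar R) :
  (forall s, 0 <= F s)%E -> (0 <= iter_int mu n F)%E.
Proof.
elim: n F => [|n IH] F F0 /=; first exact: F0.
by apply: integral_ge0 => z _; exact: IH.
Qed.

Lemma iter_int_le {R : realType} {d : nat} (mu : probability (d.-tuple R) R)
    (M : R) (n : nat) (F : seq (d.-tuple R) -> \bar R) :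
  mu (sphere d) = 1%E -> (forall s, 0 <= F s)%E ->
  (forall s, size s = n -> all (fun z => dotv z z == 1)%R s -> F s <= M%:E)%E ->
  (iter_int mu n F <= M%:E)%E.
Proof.
move=> mu1; elim: n F => [|n IH] F F0 FM /=; first exact: FM.
apply: integral_sphere_le => [//|z|z z1]; first exact: iter_int_ge0.
apply: IH => // s sn sall; apply: FM => /=; first by rewrite sn.
by rewrite sall andbT; apply/eqP.
Qed.

(** * Expectations over independent coin tosses *)

Fixpoint bernoulli_exp {R : realType} (theta : R) (n : nat) (G : seq bool -> R) : R :=
  match n with
  | 0 => G [::]
  | n'.+1 => theta * bernoulli_exp theta n' (fun s => G (true :: s))
             + (1 - theta) * bernoulli_exp theta n' (fun s => G (false :: s))
  end.

(** When the integrand sees each candidate only through the test [c], each integral is that of a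
    two-valued function, and the iterated integral becomes a finite sum. *)
Lemma iter_int_bernoulli {R : realType} {d : nat} (mu : probability (d.-tuple R) R)
    (c : d.-tuple R -> bool) (n : nat) (G : seq bool -> R) :
  measurable [set z | c z] ->
  iter_int mu n (fun s => (G (map c s))%:E) =
  (bernoulli_exp (fine (mu [set z | c z])) n G)%:E.
Proof.
move=> mc; elim: n G => [//|n IH] G /=.
set t := fine _.
rewrite (eq_integral (fun z => (if c z then bernoulli_exp t n (fun s => G (true :: s))
   else bernoulli_exp t n (fun s => G (false :: s)))%:E)).
  exact: integral_if_EFin.
by move=> z _; rewrite (IH (fun s => G (c z :: s))); case: (c z).
Qed.

Lemma bernoulli_exp_le {R : realType} (theta : R) (n : nat) (G H : seq bool -> R) :
  0 <= theta <= 1 -> (forall s, size s = n -> G s <= H s) ->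
  bernoulli_exp theta n G <= bernoulli_exp theta n H.
Proof.
move=> /andP[t0 t1]; elim: n G H => [|n IH] G H GH /=; first exact: GH.
apply: lerD; apply: ler_wpM2l => //; try lra; apply: IH => s sn;
  by apply: GH => /=; rewrite sn.
Qed.

Lemma bernoulli_exp_affine {R : realType} (theta k0 k1 : R) (n : nat) (G : seq bool -> R) :
  bernoulli_exp theta n (fun s => k0 + k1 * G s) = k0 + k1 * bernoulli_exp theta n G.
Proof. by elim: n G => [//|n IH] G /=; rewrite !IH; ring. Qed.

(** The offset [t] makes the induction work: the first toss moves it by a centred amount, so the
    cross term vanishes and one variance is added. *)
Lemma bernoulli_exp_variance {R : realType} (theta t : R) (n : nat) :
  bernoulli_exp theta n (fun s => (t + \sum_(b <- s) (b%:R - theta)) ^+ 2) =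
  t ^+ 2 + n%:R * (theta * (1 - theta)).
Proof.
elim: n t => [|n IH] t /=; first by rewrite big_nil; ring.
have E (b : bool) : (fun s : seq bool => (t + \sum_(b <- b :: s) (b%:R - theta)) ^+ 2) =
    (fun s => ((t + (b%:R - theta)) + \sum_(b <- s) (b%:R - theta)) ^+ 2).
  by apply/funext => s; rewrite big_cons addrA.
rewrite (E true) (E false) !IH -[in RHS]natr1 /=; ring.
Qed.

(* With [u] the fraction of heads and [D] the mean of the weights,
   [p0 - a u / D = a b (theta - u) / D]. *)
Lemma weighted_frequency_ge {R : realType} (theta p0 a b e delta : R) (n N : R) :
  0 < a -> 0 < b -> 0 < delta -> 0 < N -> 0 <= n <= N ->
  p0 = theta * a -> 1 - p0 = (1 - theta) * b -> 0 <= theta <= 1 -> a <= e * b -> b <= e * a ->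
  p0 - delta / 2 - e ^+ 2 / (2 * delta * N ^+ 2) * (n - N * theta) ^+ 2
  <= a * n / (a * n + b * (N - n)).
Proof.
move=> a0 b0 de0 N0 /andP[n0 nN] p0E p0E' /andP[t0 t1] aeb bea.
have e0 : 0 < e by rewrite -(pmulr_lgt0 _ b0); exact: lt_le_trans aeb.
have sum1 : theta * a + (1 - theta) * b = 1 by rewrite -p0E -p0E'; ring.
set D := a * n + b * (N - n).
have [D0 DN] : 0 < D /\ a * b * N <= e * D.
  (* The smaller of [a] and [b] is at most their mean [1], so the larger is at most [e]; and [D] is
     at least [N] times the smaller. *)
  have [ab|ba] := leP a b.
    have a1 : a <= 1 by rewrite -sum1; nra.
    have DaN : a * N <= D by rewrite /D; nra.
    split; first by apply: lt_le_trans DaN; rewrite mulr_gt0.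
    have be : b <= e by nra.
    apply: (@le_trans _ _ (e * (a * N))); last by rewrite ler_pM2l.
    by rewrite mulrA ler_pM2r// mulrC ler_pM2r.
  have b1 : b <= 1 by rewrite -sum1; nra.
  have DbN : b * N <= D by rewrite /D; nra.
  split; first by apply: lt_le_trans DbN; rewrite mulr_gt0.
  have ae : a <= e by nra.
  apply: (@le_trans _ _ (e * (b * N))); last by rewrite ler_pM2l.
  by rewrite mulrA ler_pM2r// ler_pM2r.
set T := n - N * theta.
have gapE : p0 - a * n / D = - (a * b * T) / D.
  apply: (@mulIf _ D); first by rewrite gt_eqF.
  rewrite mulrBl !divfK ?gt_eqF// /D /T.
  have -> : p0 * (a * n + b * (N - n)) - a * n =
     p0 * b * (N - n) - (1 - p0) * a * n by ring.
  by rewrite p0E' p0E; ring.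
have gap : p0 - a * n / D <= e / N * `|T|.
  rewrite gapE; apply: (@le_trans _ _ (a * b / D * `|T|)).
    have -> : - (a * b * T) / D = a * b / D * - T by ring.
    by apply: ler_wpM2l; [rewrite divr_ge0 ?mulr_ge0 ?ltW|rewrite -normrN ler_norm].
  apply: ler_wpM2r => //; by rewrite ler_pdivrMr// mulrAC ler_pdivlMr.
(* With [y = e |T| / N], the right side minus the left is [(delta - y)^2 / (2 delta)]. The bound is
   now quadratic in [T], so its expectation is a variance. *)
have amgm : e / N * `|T| <= delta / 2 + e ^+ 2 / (2 * delta * N ^+ 2) * T ^+ 2.
  have -> : T ^+ 2 = `|T| ^+ 2 by rewrite real_normK ?num_real.
  rewrite -subr_ge0.
  have -> : delta / 2 + e ^+ 2 / (2 * delta * N ^+ 2) * `|T| ^+ 2 - e / N * `|T| =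
    (delta - e / N * `|T|) ^+ 2 / (2 * delta) by field; rewrite !gt_eqF.
  by rewrite divr_ge0 ?sqr_ge0// mulr_ge0// ltW.
lra.
Qed.

(** * The mechanisms *)

Lemma sum_nth_ord {R : realType} (F : bool -> R) (N : nat) (s : seq bool) : size s = N ->
  \sum_(k < N) F (nth true s k) = \sum_(c <- s) F c.
Proof. by move=> <-; rewrite (big_nth true) big_mkord. Qed.

Section PrivUnitMRC.
Context {R : realType} {d : nat} (mu : probability (d.-tuple R) R).
Variables (p0 gamma : R) (x : d.-tuple R).
Hypothesis umu : uniform_on_sphere mu.
Hypothesis x1 : sphere d x.

Let theta := theta_bar mu gamma x.
Let a := p0 / theta.
Let b := (1 - p0) / (1 - theta).

Lemma theta_bar_ge0_le1 : 0 <= theta <= 1.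
Proof.
rewrite fine_ge0 ?measure_ge0//= -lee_fin fineK ?fin_num_measure//; last first.
  exact: measurable_cap.
by apply: probability_le1; exact: measurable_cap.
Qed.

Lemma q_pu_ge0 (z : d.-tuple R) : 0 <= p0 <= 1 -> 0 <= q_pu mu p0 gamma x z.
Proof.
move=> /andP[p00 p01]; have /andP[t0 t1] := theta_bar_ge0_le1.
by rewrite /q_pu; case: ifP => _; rewrite divr_ge0 ?subr_ge0.
Qed.

Lemma pi_mrc_ge0 (N : nat) (s : seq (d.-tuple R)) (k : nat) :
  0 <= p0 <= 1 -> 0 <= pi_mrc mu p0 gamma x N s k.
Proof.
move=> p01; rewrite divr_ge0 ?q_pu_ge0// sumr_ge0// => j _.
exact: q_pu_ge0.
Qed.

(** The sum is [1] unless the normalising sum is zero, when division by zero makes every weight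
    [0]. *)
Lemma sum_pi_mrc_le1 (N : nat) (s : seq (d.-tuple R)) :
  \sum_(k < N) pi_mrc mu p0 gamma x N s k <= 1.
Proof.
rewrite /pi_mrc -mulr_suml; set Q := \sum_(_ < _) _.
by have [->|Q0] := eqVneq Q 0; [rewrite mul0r|rewrite divff].
Qed.

(* Since the candidates are unit vectors, the squared error of [z_K / m_mrc] is
   bounded pointwise, and the law of [K] plays no role here. *)
Lemma mse_mrc_le (N : nat) (M : R) : 0 <= p0 <= 1 -> 0 <= M ->
  (forall z, sphere d z ->
    sqdist (scalev (m_mrc mu p0 gamma x N)^-1 z) x <= M) ->
  (mse_mrc mu p0 gamma x N <= M%:E)%E.
Proof.
move=> p01 M0 zM; apply: iter_int_le; first exact: umu.1.
  move=> s; rewrite lee_fin sumr_ge0// => k _.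
  by rewrite mulr_ge0 ?sqdist_ge0 ?pi_mrc_ge0.
move=> s sN sall; rewrite lee_fin.
apply: (@le_trans _ _ (\sum_(k < N) pi_mrc mu p0 gamma x N s k * M)).
  apply: ler_sum => k _; apply: ler_wpM2l; first exact: pi_mrc_ge0.
  apply: zM; rewrite /sphere/=; apply/eqP.
  by apply: (all_nthP x sall); rewrite sN.
by rewrite -mulr_suml ler_piMl// sum_pi_mrc_le1.
Qed.

(** For the upper bound, the cap of height [1/2] around [-x] has positive measure and misses the cap
    of [x], because [gamma >= 0]. *)
Lemma theta_bar_gt0_lt1 : 0 <= gamma < 1 -> 0 < theta < 1.
Proof.
move=> /andP[g0 g1]; have mc := measurable_cap gamma x.
pose y := scalev (-1) x; have my := measurable_cap 2^-1 y.
have thE : theta%:E = mu (cap gamma x) by rewrite fineK// fin_num_measure.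
rewrite -!lte_fin thE cap_measure_gt0//=.
apply: (@le_lt_trans _ _ (1 - mu (cap 2^-1 y))%E).
  rewrite -[leRHS](probability_setC mu my).
  apply: le_measure; rewrite ?inE//; first exact: measurableC.
  by move=> z [_ gz] [_]; rewrite dotvC dotv_scalel dotvC; lra.
rewrite lte_subel_addl ?fin_num_measure// lteDr//.
by apply: cap_measure_gt0 => //; [lra|exact: sphereN].
Qed.

Lemma density_ratio_le (eps : R) : 0 <= gamma < 1 -> pu_is_LDP mu p0 gamma eps ->
  a <= expR eps * b /\ b <= expR eps * a.
Proof.
move=> /andP[g0 g1] ldp.
(* The test event is the cap of height [max gamma 1/2] around [x]: it lies in the cap of [x] and
   outside that of [-x]. The [1/2] matters for [gamma = 0], where those two caps share the
   equator. *)
pose y := scalev (-1) x; have y1 : sphere d y by exact: sphereN.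
pose g := Num.max gamma 2^-1.
have gg : gamma <= g by rewrite le_max lexx.
have g2 : 2^-1 <= g by rewrite le_max lexx orbT.
have g_lt1 : g < 1 by rewrite gt_max g1/=; lra.
have mS := measurable_cap g x.
have S0 := cap_measure_gt0 mu g x umu g_lt1 x1.
have SE : mu (cap g x) = (fine (mu (cap g x)))%:E by rewrite fineK// fin_num_measure.
have thy : theta_bar mu gamma y = theta.
  by rewrite /theta /theta_bar (cap_measure_invariant mu gamma x y).
have lawx : pu_law mu p0 gamma x (cap g x) = (a * fine (mu (cap g x)))%:E.
  rewrite EFinM -SE -[RHS](integral_cst mu mS); apply: eq_integral => z.
  by rewrite inE => -[_ gz]; rewrite /q_pu (le_trans gg gz).
have lawy : pu_law mu p0 gamma y (cap g x) = (b * fine (mu (cap g x)))%:E.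
  rewrite EFinM -SE -[RHS](integral_cst mu mS); apply: eq_integral => z.
  rewrite inE => -[_ gz]; rewrite /q_pu thy ifF//; apply/negbTE.
  by rewrite -ltNge dotvC dotv_scalel dotvC; lra.
have S0' : 0 < fine (mu (cap g x)) by rewrite -lte_fin -SE.
split.
- have := ldp _ _ x1 y1 _ mS.
  by rewrite lawx lawy -EFinM lee_fin mulrA ler_pM2r.
- have := ldp _ _ y1 x1 _ mS.
  by rewrite lawx lawy -EFinM lee_fin mulrA ler_pM2r.
Qed.

Lemma p_mrc_ge (e delta : R) (N : nat) : gamma <= 1 -> 0 < theta < 1 ->
  0 < a -> 0 < b -> a <= e * b -> b <= e * a -> 0 < delta -> (0 < N)%N ->
  e ^+ 2 <= delta ^+ 2 * N%:R -> p0 - delta <= p_mrc mu p0 gamma x N.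
Proof.
move=> g1 /andP[t0 t1] a0 b0 aeb bea de0 N0 eN.
pose c (z : d.-tuple R) := gamma <= dotv z x.
have mc : measurable [set z | c z] by exact: measurable_halfspace.
have thE : fine (mu [set z | c z]) = theta by rewrite /c halfspace_measure ?umu.1.
pose w (h : bool) : R := if h then a else b.
pose G (s : seq bool) : R := \sum_(k < N)
  w (nth true s k) / (\sum_(j < N) w (nth true s j)) * (if nth true s k then 1 else 0).
(* The default values agree: [x] lies in its own cap, since [gamma <= 1]. *)
have cnth s k : nth true (map c s) k = c (nth x s k).
  have [ks|ks] := ltnP k (size s); first by rewrite (nth_map x).
  by rewrite !nth_default ?size_map// /c x1.
have -> : p_mrc mu p0 gamma x N = bernoulli_exp theta N G.
  rewrite /p_mrc -thE -[RHS]/(fine (bernoulli_exp _ N G)%:E) -(iter_int_bernoulli mu c)//.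
  congr (fine (iter_int _ _ _)); apply/funext => s; congr EFin.
  apply: eq_bigr => k _; rewrite cnth /pi_mrc; congr (_ / _ * _).
  by apply: eq_bigr => j _; rewrite cnth.
have N0' : (0 : R) < N%:R by rewrite ltr0n.
pose k1 := - (e ^+ 2 / (2 * delta * N%:R ^+ 2)).
(* The pointwise bound of [weighted_frequency_ge] has this expectation: [delta / 2] is lost at once,
   and the variance term costs at most another [delta / 2] by the hypothesis on [N]. *)
apply: (@le_trans _ _ (bernoulli_exp theta N (fun s =>
   (p0 - delta / 2) + k1 * (0 + \sum_(h <- s) (h%:R - theta)) ^+ 2))).
  rewrite bernoulli_exp_affine bernoulli_exp_variance expr0n add0r /k1.
  have tt : theta * (1 - theta) <= 1 by nra.
  have -> : p0 - delta / 2 + - (e ^+ 2 / (2 * delta * N%:R ^+ 2)) *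
      (N%:R * (theta * (1 - theta))) =
      p0 - delta / 2 - e ^+ 2 / (2 * delta * N%:R) * (theta * (1 - theta)).
    by field; rewrite !gt_eqF.
  have h1 : e ^+ 2 / (2 * delta * N%:R) <= delta / 2.
    rewrite ler_pdivrMr ?mulr_gt0//; apply: (le_trans eN).
    by rewrite le_eqVlt; apply/orP; left; apply/eqP; field.
  have h0 : 0 <= e ^+ 2 / (2 * delta * N%:R).
    by rewrite divr_ge0 ?sqr_ge0// !mulr_ge0// ltW.
  have := ler_wpM2l h0 tt; lra.
apply: bernoulli_exp_le; first by rewrite !ltW.
move=> s sN; pose n : R := \sum_(h <- s) h%:R.
have sumE (u v : R) : \sum_(h <- s) (if h then u else v) = u * n + v * (N%:R - n).
  rewrite /n -sN -sum1_size natr_sum -sumrB !mulr_sumr -big_split/=.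
  by apply: eq_bigr => h _; case: h => /=; ring.
have -> : 0 + \sum_(h <- s) (h%:R - theta) = n - N%:R * theta.
  transitivity (\sum_(h <- s) (if h then 1 - theta else 0 - theta)).
    by rewrite add0r; apply: eq_bigr => -[].
  by rewrite sumE; ring.
have -> : G s = a * n / (a * n + b * (N%:R - n)).
  rewrite /G (sum_nth_ord w)// sumE.
  have E := sum_nth_ord (fun h => w h / (a * n + b * (N%:R - n)) * (if h then 1 else 0)) _ _ sN.
  rewrite E; transitivity (\sum_(h <- s)
     (if h then a / (a * n + b * (N%:R - n)) else 0)).
    by apply: eq_bigr => -[] _ /=; rewrite ?mulr1 ?mulr0.
  by rewrite sumE mul0r addr0 mulrAC.
rewrite /k1 mulNr; apply: weighted_frequency_ge => //.
- apply/andP; split; first by apply: sumr_ge0 => h _; rewrite ler0n.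
  rewrite /n -sN -sum1_size natr_sum; apply: ler_sum => h _.
  by rewrite ler_nat; case: h.
- by rewrite /a mulrC divfK// gt_eqF.
- by rewrite /b mulrC divfK// gt_eqF// subr_gt0.
- by rewrite !ltW.
Qed.

Lemma mse_pu_ge0 : 0 <= p0 <= 1 -> 0 <= fine (mse_pu mu p0 gamma x).
Proof.
move=> p01; apply: fine_ge0; apply: integral_ge0 => z _.
by rewrite lee_fin mulr_ge0 ?q_pu_ge0 ?sqdist_ge0.
Qed.

(** On the sphere the squared error is at least [(m - 1)^2], where [m] is the inverse normaliser,
    and the density integrates to [1]. *)
Lemma mse_pu_ge : 0 <= p0 <= 1 -> 0 < theta < 1 -> 0 <= m_fun d gamma p0 ->
  (m_fun d gamma p0)^-1 <= 1 + Num.sqrt (fine (mse_pu mu p0 gamma x)).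
Proof.
move=> p01 /andP[t0 t1]; set m := (m_fun d gamma p0)^-1 => m0'.
have m0 : 0 <= m by rewrite invr_ge0.
have [p00 p01'] := andP p01.
have a0 : 0 <= a by rewrite divr_ge0// ltW.
have b0 : 0 <= b by rewrite divr_ge0 ?subr_ge0// ltW.
pose f (z : d.-tuple R) := (q_pu mu p0 gamma x z * sqdist (scalev m z) x)%:E.
have f0 z : (0 <= f z)%E by rewrite lee_fin mulr_ge0 ?q_pu_ge0 ?sqdist_ge0.
(* Finiteness matters because [fine] would send an infinite error to [0]. *)
have fin : mse_pu mu p0 gamma x \is a fin_num.
  rewrite ge0_fin_numE; last by apply: integral_ge0 => z _; exact: f0.
  apply: (@le_lt_trans _ _ ((a + b) * (m + 1) ^+ 2)%:E); last exact: ltry.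
  apply: integral_sphere_le => //; first exact: umu.1.
  move=> z z1; rewrite lee_fin; apply: ler_pM; rewrite ?q_pu_ge0 ?sqdist_ge0//.
    by rewrite /q_pu; case: ifP => _; rewrite ?lerDl ?lerDr.
  rewrite -/m sqdist_scalev//; have /andP[h _] := dotv_unit_itv z x z1 x1.
  have : 0 <= m * (dotv z x + 1) by rewrite mulr_ge0//; lra.
  by rewrite !expr2; lra.
have ms := measurable_sphere R d.
pose K := (m - 1) ^+ 2.
pose h (z : d.-tuple R) := (if gamma <= dotv z x then a * K else b * K)%:E.
have h0 z : (0 <= h z)%E by rewrite /h; case: ifP => _; rewrite lee_fin mulr_ge0 ?sqr_ge0.
have mh : measurable_fun [set: d.-tuple R] h.
  apply/measurable_EFinP; apply: measurable_fun_ifT => //.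
  by apply: (measurable_fun_bool true); rewrite setTI; exact: measurable_halfspace.
have KE : (K%:E <= mse_pu mu p0 gamma x)%E.
  have -> : K%:E = (\int[mu]_z h z)%E.
    rewrite integral_if_EFin; last exact: measurable_halfspace.
    rewrite halfspace_measure ?umu.1// -/(theta_bar mu gamma x) -/theta.
    by rewrite /a /b; congr EFin; field; apply/andP; split; lra.
  have muC : mu (~` sphere d) = 0%E.
    by rewrite [LHS](probability_setC mu ms) umu.1 subee.
  rewrite (@ge0_negligible_integral _ _ _ mu setT (~` sphere d))//; last first.
    exact: measurableC.
  rewrite setDE setCK setTI integral_mkcond.
  apply: ge0_le_integralT => z; first by rewrite patchE; case: ifP.
  rewrite patchE; case: ifPn => [|_]; last exact: f0.
  rewrite inE => z1; rewrite /h /f /q_pu sqdist_scalev//.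
  have /andP[_ hz] := dotv_unit_itv z x z1 x1.
  have le : K <= m ^+ 2 - 2 * m * dotv z x + 1.
    have : 0 <= m * (1 - dotv z x) by rewrite mulr_ge0// subr_ge0.
    by rewrite /K !expr2; lra.
  by case: ifP => _; rewrite lee_fin ler_wpM2l.
have : `|m - 1| <= Num.sqrt (fine (mse_pu mu p0 gamma x)).
  rewrite -sqrtr_sqr; apply: ler_wsqrtr.
  by rewrite -lee_fin fineK.
by have := ler_norm (m - 1); lra.
Qed.

End PrivUnitMRC.

Theorem theorem10 (R : realType) (d : nat) (mu : probability (d.-tuple R) R)
  (p0 gamma eps lambda : R) (N : nat) :
  (2 <= d)%N ->
  uniform_on_sphere mu ->
  0 <= gamma <= 1 ->
  1 / 2 < p0 <= 1 ->
  pu_is_LDP mu p0 gamma eps ->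
  0 < lambda ->
  2 * expR (2 * eps) *
    (2 * (1 + lambda) / (lambda * (p0 - 1 / 2))) ^+ 2 *
    ln (4 * (1 + lambda) / (lambda * (p0 - 1 / 2))) <= N%:R ->
  forall x : d.-tuple R, sphere d x ->
    let E := fine (mse_pu mu p0 gamma x) in
    (mse_mrc mu p0 gamma x N <=
      ((1 + lambda) ^+ 2 * E + 2 * (1 + lambda) * (2 + lambda) * Num.sqrt E
       + (2 + lambda) ^+ 2)%:E)%E.
Proof.
move=> d2 umu /andP[g0 g1] /andP[p0gt p0le] ldp l0 HN x x1; cbv zeta.
set E := fine (mse_pu mu p0 gamma x).
have p01 : 0 <= p0 <= 1 by apply/andP; split; lra.
have E0 : 0 <= E by exact: mse_pu_ge0.
set S := Num.sqrt E; have S0 : 0 <= S by exact: sqrtr_ge0.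
(* The bound is a perfect square, so it is enough that [1 / m_mrc + 1] is at most its root. *)
have -> : (1 + lambda) ^+ 2 * E + 2 * (1 + lambda) * (2 + lambda) * S
    + (2 + lambda) ^+ 2 = ((1 + lambda) * S + (2 + lambda)) ^+ 2.
  by rewrite -(sqr_sqrtr E0) -/S; ring.
have B0 : 0 <= (1 + lambda) * S by rewrite mulr_ge0//; lra.
apply: mse_mrc_le => //; first exact: sqr_ge0.
move=> z z1; rewrite sqdist_scalev//; set m := (m_mrc _ _ _ _ _)^-1.
suff m_le : 0 <= m <= (1 + lambda) * (S + 1).
  have /andP[m0 mle] := m_le; have /andP[h _] := dotv_unit_itv z x z1 x1.
  apply: (@le_trans _ _ ((m + 1) ^+ 2)).
    have : 0 <= m * (dotv z x + 1) by rewrite mulr_ge0//; lra.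
    by rewrite !expr2; lra.
  by rewrite lerXn2r ?nnegrE; lra.
have [g1E|gneq1] := eqVneq gamma 1.
  rewrite /m /m_mrc g1E m_fun1// invr0 lexx/= mulr_ge0//; lra.
have glt1 : 0 <= gamma < 1 by rewrite g0 lt_neqAle gneq1.
have /andP[t0 t1] := theta_bar_gt0_lt1 mu gamma x umu x1 glt1.
have [aeb bea] := density_ratio_le mu p0 gamma x umu x1 eps glt1 ldp.
set th := theta_bar mu gamma x in t0 t1 aeb bea.
have a0 : 0 < p0 / th by rewrite divr_gt0//; lra.
(* This excludes [p0 = 1]: the LDP ratio bound forces the density off the cap to be positive. *)
have b0 : 0 < (1 - p0) / (1 - th).
  by rewrite -(pmulr_rgt0 _ (expR_gt0 eps)); exact: lt_le_trans aeb.
have [delta deltaE] : exists t, t = lambda * (p0 - 1 / 2) / (1 + lambda) by eexists.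
have de0 : 0 < delta by rewrite deltaE divr_gt0 ?mulr_gt0//; lra.
have de1 : delta <= 1.
  rewrite deltaE ler_pdivrMr; last by lra.
  have : 0 <= lambda * (1 - (p0 - 1 / 2)) by rewrite mulr_ge0 ?ltW//; lra.
  lra.
have l1 : 1 + lambda != 0 by apply/eqP; lra.
have e2N : 6 * expR eps ^+ 2 <= delta ^+ 2 * N%:R.
  (* Since [delta <= 1], [ln (delta / 4) <= delta / 4 - 1 <= -3/4]. The constant [6] is then
     [2 * 2^2 * 3/4]. *)
  have ln34 : 3 / 4 <= ln (4 / delta).
    have H : ln (delta / 4) <= delta / 4 - 1.
      by rewrite -{1}[delta / 4](subrKC 1) le_ln1Dx//; lra.
    have -> : 4 / delta = (delta / 4)^-1 by rewrite invf_div.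
    by rewrite lnV ?posrE ?divr_gt0//; lra.
  have -> : 6 * expR eps ^+ 2 = delta ^+ 2 *
      (2 * expR (2 * eps) * (2 / delta) ^+ 2 * (3 / 4)).
    have -> : expR (2 * eps) = expR eps ^+ 2.
      by rewrite expr2 -expRD; congr expR; ring.
    by field; rewrite gt_eqF.
  rewrite ler_pM2l ?exprn_gt0//; apply: le_trans HN.
  have -> : 4 * (1 + lambda) / (lambda * (p0 - 1 / 2)) = 4 / delta.
    by rewrite deltaE invf_div mulrA.
  have -> : 2 * (1 + lambda) / (lambda * (p0 - 1 / 2)) = 2 / delta.
    by rewrite deltaE invf_div mulrA.
  apply: ler_wpM2l ln34; apply: mulr_ge0; last exact: sqr_ge0.
  by rewrite mulr_ge0 ?expR_ge0.
have N0 : (0 < N)%N.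
  rewrite lt0n; apply/eqP => N0; move: e2N; rewrite N0 mulr0.
  by have := exprn_gt0 2 (expR_gt0 eps); lra.
have pge : p0 - delta <= p_mrc mu p0 gamma x N.
  apply: (p_mrc_ge mu p0 gamma x umu x1 (expR eps)) => //; first by rewrite t0.
  by have := sqr_ge0 (expR eps); lra.
have [c0 [c1 [c00 c10 mE]]] := m_fun_affine R d gamma d2 glt1.
have mp0 : 0 < m_fun d gamma p0.
  by rewrite mE ltr_wpDl// mulr_gt0// subr_gt0.
have mle : m_fun d gamma p0 <= (1 + lambda) * m_mrc mu p0 gamma x N.
  rewrite /m_mrc !mE.
  (* [delta] is the solution of [(1 + lambda) (p0 - delta - 1/2) = p0 - 1/2]. Passing to [m] keeps
     the inequality because [c0 <= (1 + lambda) c0]. *)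
  have h : p0 - 1 / 2 <= (1 + lambda) * (p_mrc mu p0 gamma x N - 1 / 2).
    have -> : p0 - 1 / 2 = (1 + lambda) * (p0 - delta - 1 / 2).
      by rewrite deltaE; field.
    by rewrite ler_pM2l; lra.
  have := ler_wpM2l (ltW c10) h; have := mulr_ge0 (ltW l0) c00; lra.
have mm0 : 0 < m_mrc mu p0 gamma x N.
  by rewrite -(@pmulr_rgt0 _ (1 + lambda)); [exact: lt_le_trans mle|lra].
rewrite /m invr_ge0 (ltW mm0)/=.
apply: (@le_trans _ _ ((1 + lambda) * (m_fun d gamma p0)^-1)).
  rewrite -ler_pdivrMl; last by lra.
  by rewrite -invfM lef_pV2 ?posrE// mulr_gt0//; lra.
rewrite ler_pM2l; last by lra.
rewrite addrC; apply: mse_pu_ge => //; first by rewrite t0.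
exact: ltW.
Qed.
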